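(* There is an absolute constant $C>0$ such that the following holds. Let $A\in\mathbb{R}^{m\times n}$, $1\le k\le\min\{m,n\}$, and let $S,T\in\mathcal{I}$ with $S\neq T$. Then \[ \lvert\det(A_S)\rvert\cdot\lvert\det(A_T)\rvert\;\le\;Ck^2\max\big\{\lvert\det(A_{S\Delta U})\rvert\cdot\lvert\det(A_{T\Delta U})\rvert : U\in\mathcal{E}(S,T)\big\}. \]
   Context: $\mathcal{I}=\binom{[m]}{k}\times\binom{[n]}{k}$ is the set of pairs $S=(R_S,C_S)$ with $R_S\subseteq[m]$, $C_S\subseteq[n]$, $\lvert R_S\rvert=\lvert C_S\rvert=k$; $A_S$ is the $k\times k$ submatrix with rows $R_S$ and columns $C_S$. Set operations on pairs are componentwise: for $S=(R_S,C_S)$, $U=(R_U,C_U)$, $S\Delta U=(R_S\Delta R_U, C_S\Delta C_U)$, $U\subseteq W$ means $R_U\subseteq R_W$ and $C_U\subseteq C_W$, and $\lvert U\rvert=\lvert R_U\rvert+\lvert C_U\rvert$. For $S,T\in\mathcal{I}$, a pair $U=(R_U,C_U)$ is an $r$-exchange between $S$ and $T$ if $U\subseteq S\Delta T$, $\lvert U\rvert=2r$, and both $S\Delta U$ and $T\Delta U$ belong to $\mathcal{I}$ (i.e. all four component sets have size $k$). $\mathcal{E}(S,T)$ is the set of all $1$-exchanges and $2$-exchanges between $S$ and $T$. (The paper writes the factor as $O(k^2)$.) *)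

(* Defs.v *)
From HB Require Import structures.
From mathcomp Require Import all_boot all_order all_algebra.
From mathcomp Require Import reals.

Set Implicit Arguments.
Unset Strict Implicit.
Unset Printing Implicit Defensive.

Import Order.TTheory GRing.Theory Num.Theory.
Local Open Scope ring_scope.

Definition symdiff (T : finType) (X Y : {set T}) : {set T} :=
  (X :\: Y) :|: (Y :\: X).

(* The pair (R_S, C_S) of a set of row indices and a set of column indices. *)
Definition idxpair (m n : nat) : finType := ({set 'I_m} * {set 'I_n})%type.

Definition pair_symdiff (m n : nat) (S U : idxpair m n) : idxpair m n :=
  (symdiff S.1 U.1, symdiff S.2 U.2).

Definition pair_subset (m n : nat) (U W : idxpair m n) : bool :=
  (U.1 \subset W.1) && (U.2 \subset W.2).

Definition pair_card (m n : nat) (U : idxpair m n) : nat := (#|U.1| + #|U.2|)%N.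

Definition index_set (m n k : nat) : {set idxpair m n} :=
  [set S : idxpair m n | (#|S.1| == k) && (#|S.2| == k)].

(* A_S, rows and columns taken in increasing order (enum_val enumerates a set
   of ordinals increasingly).  conform_mx only retypes the #|S.1| x #|S.2|
   submatrix as k x k; see submatrixE.  The value 0 for S outside
   index_set m n k is a dummy. *)
Definition submatrix (R : pzRingType) (m n k : nat) (A : 'M[R]_(m, n))
    (S : idxpair m n) : 'M[R]_k :=
  conform_mx (0 : 'M[R]_k)
    (mxsub (fun i : 'I_#|S.1| => enum_val i) (fun j : 'I_#|S.2| => enum_val j) A).

Definition is_exchange (m n k r : nat) (S T U : idxpair m n) : bool :=
  [&& pair_subset U (pair_symdiff S T), pair_card U == (2 * r)%N,
      pair_symdiff S U \in index_set m n k
    & pair_symdiff T U \in index_set m n k].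

Definition exchanges (m n k : nat) (S T : idxpair m n) : {set idxpair m n} :=
  [set U : idxpair m n | is_exchange k 1 S T U || is_exchange k 2 S T U].

(* The terms are nonnegative and exchanges k S T is nonempty for distinct S, T
   in index_set m n k (exchanges_neq0), so the initial value 0 does not affect
   the maximum. *)
Definition max_exchange (R : realType) (m n k : nat) (A : 'M[R]_(m, n))
    (S T : idxpair m n) : R :=
  \big[Num.max/0]_(U in exchanges k S T)
    (`|\det (submatrix k A (pair_symdiff S U))| *
     `|\det (submatrix k A (pair_symdiff T U))|).

Lemma submatrixE (R : pzRingType) (m n k : nat) (A : 'M[R]_(m, n))
    (S : idxpair m n) (hR : k = #|S.1|) (hC : k = #|S.2|) (i j : 'I_k) :
  submatrix k A S i j = A (enum_val (cast_ord hR i)) (enum_val (cast_ord hC j)).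
Proof.
rewrite /submatrix /conform_mx; case: eqP => [e1|]; last by move=> ne; case: (ne (esym hR)).
case: eqP => [e2|]; last by move=> ne; case: (ne (esym hC)).
by rewrite castmxE mxE; congr (fun_of_matrix A _ _); congr enum_val; apply: val_inj.
Qed.

Lemma exchanges_neq0 (m n k : nat) (S T : idxpair m n) :
  S \in index_set m n k -> T \in index_set m n k -> S != T ->
  exchanges k S T != set0.
Proof.
have ex1 (I : finType) (X Y : {set I}) : #|X| = #|Y| -> X != Y ->
    exists U : {set I}, [/\ U \subset symdiff X Y, #|U| = 2,
      #|symdiff X U| = #|X| & #|symdiff Y U| = #|Y|].
  move=> eXY neXY.
  have /subsetPn[x xX xNY] : ~~ (X \subset Y).
    by apply/negP => sXY; move: neXY; rewrite eqEcard sXY eXY leqnn.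
  have /subsetPn[y yY yNX] : ~~ (Y \subset X).
    by apply/negP => sYX; move: neXY; rewrite eq_sym eqEcard sYX eXY leqnn.
  have neq : x != y by apply: contraNneq xNY => ->.
  have sw (Z : {set I}) u v : u \in Z -> v \notin Z ->
      #|symdiff Z [set u; v]| = #|Z|.
    move=> uZ vNZ; have -> : symdiff Z [set u; v] = v |: (Z :\ u).
      apply/setP => z; rewrite !inE; case: (eqVneq z u) => [->|_] /=.
        by rewrite uZ /=; case: eqVneq => // e; move: vNZ; rewrite -e uZ.
      by case: (eqVneq z v) => [->|_]; rewrite ?vNZ ?andbF ?orbF.
    by rewrite cardsU1 !inE (negPf vNZ) andbF (cardsD1 u Z) uZ.
  exists [set x; y]; split.
  - apply/subsetP => z; rewrite !inE => /orP[/eqP->|/eqP->].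
      by rewrite xX xNY.
    by rewrite yY yNX orbT.
  - by rewrite cards2 neq.
  - exact: sw.
  - by rewrite setUC sw.
have sd0 (I : finType) (X : {set I}) : symdiff X set0 = X.
  by rewrite /symdiff setD0 set0D setU0.
case: S T => [RS CS] [RT CT]; rewrite !inE /=.
move=> /andP[/eqP hRS /eqP hCS] /andP[/eqP hRT /eqP hCT] neST.
apply/set0Pn; have [eR|neR] := eqVneq RS RT.
  have neC : CS != CT by apply: contraNneq neST => ->; rewrite eR.
  have [|U [sU cU cS cT]] := ex1 _ CS CT _ neC; first by rewrite hCS.
  exists (set0, U); rewrite inE /is_exchange /pair_subset /pair_card !inE /=.
  by rewrite !sd0 sub0set sU cards0 cU cS cT hRS hRT hCS hCT !eqxx.
have [|U [sU cU cS cT]] := ex1 _ RS RT _ neR; first by rewrite hRS.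
exists (U, set0); rewrite inE /is_exchange /pair_subset /pair_card !inE /=.
by rewrite !sd0 sub0set sU cards0 cU cS cT hRS hRT hCS hCT !eqxx.
Qed.

(* Main.v *)
Require Import Defs.
From mathcomp Require Import all_boot all_order all_algebra all_fingroup.
From mathcomp Require Import ring lra.
From mathcomp Require Import reals.
Set Implicit Arguments.
Unset Strict Implicit.
Unset Printing Implicit Defensive.
Import Order.TTheory GRing.Theory Num.Theory.
Local Open Scope ring_scope.

(** Enumerate the rows of [S], [T] by [r], [r'] and their columns by [c], [c'],
    so that common indices occupy common positions, and put [Z = A_(r,c)],
    [X = A_(r',c)], [Y = A_(r,c')], [W = A_(r',c')].  If [Z] or [W] is singular
    there is nothing to prove.  Otherwise an exchange changes [Z] and [W] by
    matrices of rank at most 2, so relative to [det Z * det W] the value of a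
    row swap is [E_ji E'_ij] with [E = X Z^-1], [E' = Y W^-1], that of a column
    swap is [H_lq H'_ql] with [H = Z^-1 Y], [H' = W^-1 X], that of two row swaps
    is a product of 2x2 minors of [E] and [E'], and that of a row swap combined
    with a column swap is
    [(E_ji H_lq + (Z^-1)_li (W - E Y)_jq) (E'_ij H'_ql + (W^-1)_qj (Z - E' X)_il)].

    Let [a], [b] be the numbers of non-common rows and columns, and [tau], [tauc],
    [rho], [mu] the sums of these four kinds of ratios over the non-common
    positions.  All of them are functions of the traces of [Q = E E'] and [Q^2].
    Firstly [tau - a = tauc - b], so if [a <> b] some 1-exchange has ratio at
    least [1 / (a^2 + b^2)].  If [a = b], eliminating [tr Q^2] gives
    [a^2 = mu - rho + 2 (a - 1) tau], where [mu] and [rho] have [a^4] terms each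
    and [tau] has [a^2], so some ratio is at least [1 / (4 a^2)].  Hence [C = 4]. *)

(** * Determinants of low-rank perturbations *)

(** Sylvester's identity: both block triangular products in [e] equal the block matrix with rows
    [(1, - X)] and [(Y, 1)]. *)
Lemma det_addmulC (F : comNzRingType) (p q : nat) (X : 'M[F]_(p, q)) (Y : 'M_(q, p)) :
  \det (1%:M + X *m Y) = \det (1%:M + Y *m X).
Proof.
have e : block_mx (1%:M + X *m Y) (- X) 0 1%:M *m block_mx 1%:M 0 Y 1%:M =
         block_mx 1%:M 0 Y 1%:M *m block_mx 1%:M (- X) 0 (1%:M + Y *m X).
  rewrite !mulmx_block !(mulmx1, mul1mx, mulmx0, mul0mx, addr0, add0r, mulNmx, mulmxN).
  by rewrite addrK addrC addrK.
move/(congr1 determinant): e.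
by rewrite !det_mulmx !det_ublock !det_lblock !det1 !mulr1 !mul1r.
Qed.

(** Factoring out [Z] and applying Sylvester's identity replaces a determinant of size [k] by one of
    size [q]. *)
Lemma det_add_mul (F : fieldType) (k q : nat) (Z : 'M[F]_k) (X : 'M_(k, q)) (Y : 'M_(q, k)) :
  Z \in unitmx -> \det (Z + X *m Y) = \det Z * \det (1%:M + Y *m invmx Z *m X).
Proof.
move=> uZ; rewrite -mulmxA -det_addmulC -det_mulmx.
by rewrite mulmxDr mulmx1 -mulmxA mulKVmx.
Qed.

Lemma det_add_rank1 (F : fieldType) (k : nat) (Z : 'M[F]_k) (x : 'cV_k) (y : 'rV_k) :
  Z \in unitmx -> \det (Z + x *m y) = \det Z * (1 + (y *m invmx Z *m x) 0 0).
Proof. by move=> uZ; rewrite det_add_mul // det_mx11 !mxE. Qed.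

Lemma det_mx22 (F : comNzRingType) (M : 'M[F]_(1 + 1)) :
  \det M = M 0 0 * M 1 1 - M 0 1 * M 1 0.
Proof.
rewrite (expand_det_row _ 0) !big_ord_recl big_ord0 addr0 /cofactor /=.
rewrite !det_mx11 !mxE /= expr0 expr1 mul1r mulN1r mulrN.
by congr (_ * M _ _ - M _ _ * M _ _); apply/val_inj.
Qed.

Lemma det_add_rank2 (F : fieldType) (k : nat) (Z : 'M[F]_k) (x1 x2 : 'cV_k) (y1 y2 : 'rV_k) :
  Z \in unitmx ->
  let V := invmx Z in
  \det (Z + (x1 *m y1 + x2 *m y2)) =
  \det Z * ((1 + (y1 *m V *m x1) 0 0) * (1 + (y2 *m V *m x2) 0 0)
            - (y1 *m V *m x2) 0 0 * (y2 *m V *m x1) 0 0).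
Proof.
move=> uZ V; rewrite -mul_row_col det_add_mul //; congr (_ * _).
rewrite mul_col_mx mul_col_row -/V (scalar_mx_block 1 1 1) add_block_mx !add0r det_mx22.
(* Both indices are written as block shifts, so that the four blocks can be read off. *)
rewrite -[0 : 'I_(1 + 1)](_ : lshift 1 (0 : 'I_1) = _); last exact/val_inj.
rewrite -[1 : 'I_(1 + 1)](_ : rshift 1 (0 : 'I_1) = _); last exact/val_inj.
rewrite block_mxEul block_mxEur block_mxEdl block_mxEdr.
by rewrite ![(1%:M + _) _ _]mxE !mxE.
Qed.

Lemma col_mul (F : pzRingType) (m n p : nat) (M : 'M[F]_(m, n)) (N : 'M_(n, p)) j :
  col j (M *m N) = M *m col j N.
Proof. by rewrite !colE mulmxA. Qed.

(** * Determinant ratios after replacing rows or columns *)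

Definition upd (I : eqType) (J : Type) (f : I -> J) (i : I) (y : J) : I -> J :=
  fun x => if x == i then y else f x.

Section Replacement.

Variables (F : fieldType) (m n k : nat) (A : 'M[F]_(m, n)).
Variables (r r' : 'I_k -> 'I_m) (c c' : 'I_k -> 'I_n).

Let Z := mxsub r c A.
Let X := mxsub r' c A.
Let Y := mxsub r c' A.
Let W := mxsub r' c' A.

Hypothesis uZ : Z \in unitmx.

(** This row enters the low-rank formulas when row [i] of [Z] becomes row [j] of [X]; [invmx Z]
    turns the old row into a unit vector. *)
Lemma row_update i j p :
  ((row j X - row i Z) *m invmx Z) 0 p = (X *m invmx Z) j p - (i == p)%:R.
Proof. by rewrite mulmxBl -!row_mul mulmxV // !mxE. Qed.

Lemma det_replace_row i j :
  \det (mxsub (upd r i (r' j)) c A) = \det Z * (X *m invmx Z) j i.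
Proof.
have -> : mxsub (upd r i (r' j)) c A = Z + delta_mx i 0 *m (row j X - row i Z).
  apply/matrixP => p q; rewrite !mxE big_ord1 !mxE /upd eqxx andbT.
  by case: eqVneq => [->|_] /=; rewrite ?mul1r ?mul0r ?addr0 // addrC subrK.
rewrite det_add_rank1 // -colE mxE row_update eqxx; congr (_ * _).
by rewrite addrC subrK.
Qed.

Lemma det_replace_col l q :
  \det (mxsub r (upd c l (c' q)) A) = \det Z * (invmx Z *m Y) l q.
Proof.
have -> : mxsub r (upd c l (c' q)) A = Z + (col q Y - col l Z) *m delta_mx 0 l.
  apply/matrixP => p o; rewrite !mxE big_ord1 !mxE /upd eqxx /=.
  by case: eqVneq => [->|_] /=; rewrite ?mulr1 ?mulr0 ?addr0 // addrC subrK.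
rewrite det_add_rank1 // -mulmxA -rowE row_mul mulmxBr -!row_mul -!col_mul mulVmx // !mxE eqxx.
by congr (_ * _); rewrite addrCA subrr addr0.
Qed.

(** The subtracted unit vectors cancel the ones on the diagonal and, as [i != i'], do not touch the
    off-diagonal entries. A 2x2 minor of [E] remains. *)
Lemma det_replace_2rows i j i' j' : i != i' ->
  let E := X *m invmx Z in
  \det (mxsub (upd (upd r i (r' j)) i' (r' j')) c A) =
  \det Z * (E j i * E j' i' - E j i' * E j' i).
Proof.
move=> ne E.
have -> : mxsub (upd (upd r i (r' j)) i' (r' j')) c A =
  Z + (delta_mx i 0 *m (row j X - row i Z) + delta_mx i' 0 *m (row j' X - row i' Z)).
  apply/matrixP => p q; rewrite !mxE !big_ord1 !mxE /upd eqxx !andbT.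
  case: (eqVneq p i') => [->|_] /=.
    by rewrite eq_sym (negPf ne) mul0r add0r mul1r addrC subrK.
  by case: eqVneq => [->|_] /=; rewrite ?mul1r ?mul0r ?addr0 // addrC subrK.
rewrite det_add_rank2 // -!colE ![col _ _ _ _]mxE !row_update !eqxx -/E.
rewrite (negPf ne) eq_sym (negPf ne); congr (_ * _); rewrite /= ?mulr1n ?mulr0n; ring.
Qed.

(** [W - E *m Y] is the Schur complement of [Z] in the block matrix with rows [(Z, Y)] and
    [(X, W)]. *)
Lemma det_replace_row_col i j l q :
  let G := invmx Z in let E := X *m G in let H := G *m Y in
  \det (mxsub (upd r i (r' j)) (upd c l (c' q)) A) =
  \det Z * (E j i * H l q + G l i * (W - E *m Y) j q).
Proof.
(* The two replacements overlap at position [(i, l)]; [g] corrects that entry to [W j q]. *)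
move=> G E H; pose g := W j q - X j l - Y i q + Z i l.
have -> : mxsub (upd r i (r' j)) (upd c l (c' q)) A =
  Z + (delta_mx i 0 *m (row j X - row i Z)
       + (col q Y - col l Z + g *: delta_mx i 0) *m delta_mx 0 l).
  apply/matrixP => o p; rewrite !mxE !big_ord1 !mxE /upd !eqxx !andbT /= /g !mxE.
  by case: (eqVneq o i) => [->|_]; case: (eqVneq p l) => [->|_] /=; ring.
rewrite det_add_rank2 // -/G.
rewrite -!colE ![col _ _ _ _]mxE !row_update eqxx -/G -/E.
rewrite !mulmxDr !mulmxN -scalemxAr -colE -![delta_mx 0 l *m G]rowE.
rewrite mulmxBl.
have e1 : row l G *m col q Y = (H l q)%:M.
  by rewrite -row_mul -col_mul [LHS]mx11_scalar !mxE.
have e2 : row l G *m col l Z = 1%:M.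
  by rewrite -row_mul -col_mul mulVmx // [LHS]mx11_scalar !mxE eqxx.
have e3 : row j X *m G *m col q Y = ((E *m Y) j q)%:M.
  by rewrite -!row_mul -col_mul [LHS]mx11_scalar !mxE.
have e4 : row j X *m G *m col l Z = (X j l)%:M.
  by rewrite -!row_mul -col_mul mulmxKV // [LHS]mx11_scalar !mxE.
have e5 : row i Z *m G *m col q Y = (Y i q)%:M.
  by rewrite -!row_mul -col_mul mulmxV // mul1mx [LHS]mx11_scalar !mxE.
have e6 : row i Z *m G *m col l Z = (Z i l)%:M.
  by rewrite -!row_mul -col_mul mulmxV // mul1mx [LHS]mx11_scalar !mxE.
rewrite !mulmxBl e1 e2 e3 e4 e5 e6.
have e7 : row j X *m G = row j E by rewrite row_mul.
have e8 : row i Z *m G = row i 1%:M by rewrite -row_mul mulmxV.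
rewrite e7 e8 /g.
have -> : (W - E *m Y) j q = W j q - (E *m Y) j q by rewrite !mxE.
have aD (M N : 'M[F]_1) : (M + N) 0 0 = M 0 0 + N 0 0 by rewrite mxE.
have aN (M : 'M[F]_1) : (- M) 0 0 = - M 0 0 by rewrite mxE.
have aZ a (M : 'M[F]_1) : (a *: M) 0 0 = a * M 0 0 by rewrite mxE.
have aS (a : F) : (a%:M : 'M[F]_1) 0 0 = a by rewrite mxE eqxx.
have aB (u v : 'rV[F]_k) : col i (u - v) 0 0 = u 0 i - v 0 i by rewrite !mxE.
have aR (M : 'M[F]_k) p : row p M 0 i = M p i by rewrite mxE.
have aC p : col i (row p G) 0 0 = G p i by rewrite !mxE.
have aX (M : 'rV[F]_k) a : (M *m (a *: (delta_mx i 0 : 'cV_k))) 0 0 = a * M 0 i.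
  by rewrite -scalemxAr -[M *m _]colE !mxE.
rewrite !(aD, aN, aZ, aS, aB, aX, aR, aC).
rewrite [1%:M i i]mxE !eqxx ?mulr1n.
congr (_ * _); ring.
Qed.

End Replacement.

(** * Matrices with identity rows outside a set of positions *)

(** At a common position [X] and [Z] share a row, so [X *m invmx Z] has a unit row there. Stated for
    whole rows, the property passes to products. *)
Definition fixes_rows (F : pzRingType) (k : nat) (N : {set 'I_k}) (E : 'M[F]_k) :=
  forall i, i \notin N -> row i E = row i 1%:M.

Lemma big_supp (V : nmodType) (I : finType) (N : {set I}) (f : I -> V) :
  (forall i, i \notin N -> f i = 0) -> \sum_(i in N) f i = \sum_i f i.
Proof.
move=> h; rewrite big_mkcond; apply: eq_bigr => i _.
by case: ifPn => // /h.
Qed.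

Lemma fixes_rowsE (F : pzRingType) (k : nat) (N : {set 'I_k}) (E : 'M[F]_k) i j :
  fixes_rows N E -> i \notin N -> E i j = (i == j)%:R.
Proof. by move=> h /h /rowP /(_ j); rewrite !mxE. Qed.

Lemma fixes_rows0 (F : pzRingType) (k : nat) (N : {set 'I_k}) (E : 'M[F]_k) i j :
  fixes_rows N E -> i \notin N -> j \in N -> E i j = 0.
Proof.
move=> h iN jN; rewrite (fixes_rowsE _ h iN).
by case: eqVneq iN => // ->; rewrite jN.
Qed.

Lemma fixes_rowsM (F : pzRingType) (k : nat) (N : {set 'I_k}) (E E' : 'M[F]_k) :
  fixes_rows N E -> fixes_rows N E' -> fixes_rows N (E *m E').
Proof.
by move=> h h' i iN; rewrite row_mul h // -row_mul mul1mx h'.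
Qed.

(** For [j] in [N] the entries [E' p j] with [p] outside [N] vanish. *)
Lemma fixes_rows_sum (F : pzRingType) (k : nat) (N : {set 'I_k}) (E E' : 'M[F]_k) i j :
  fixes_rows N E' -> j \in N ->
  \sum_(p in N) E i p * E' p j = (E *m E') i j.
Proof.
move=> h jN; rewrite mxE big_supp // => p pN.
by rewrite (fixes_rows0 h pN jN) mulr0.
Qed.

(** Each of the [k - #|N|] positions outside [N] has diagonal entry 1. *)
Lemma fixes_rows_trace (F : comNzRingType) (k : nat) (N : {set 'I_k}) (E : 'M[F]_k) :
  fixes_rows N E -> \sum_(i in N) E i i = \tr E - (k%:R - #|N|%:R).
Proof.
move=> h; rewrite /mxtrace [in RHS](bigID (mem N)) /= -[RHS]addrA.
rewrite [X in _ + (X - _)](eq_bigr (fun=> 1)) => [|i iN]; last first.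
  by rewrite (fixes_rowsE _ h iN) eqxx.
rewrite sumr_const; have -> : k%:R - #|N|%:R = #|[pred i | i \notin N]|%:R :> F.
  apply/eqP; rewrite subr_eq -natrD addnC; have := cardC (mem N).
  by rewrite card_ord => e; apply/eqP; congr (_%:R); rewrite -[LHS]e; congr addn; apply: eq_card.
by rewrite subrr addr0.
Qed.

Lemma norm_sum_le (F : realDomainType) (I : finType) (N : {set I}) (f : I -> F) e :
  (forall i, i \in N -> `|f i| <= e) -> `|\sum_(i in N) f i| <= #|N|%:R * e.
Proof.
move=> h; apply: le_trans (ler_norm_sum _ _ _) _.
by rewrite mulr_natl -sumr_const; apply: ler_sum.
Qed.

Lemma sum_supp_trace (F : comNzRingType) (k : nat) (Nr Nc : {set 'I_k}) (K M : 'M[F]_k) :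
  (forall i l, i \notin Nr -> M i l = 0) -> (forall i l, l \notin Nc -> M i l = 0) ->
  \sum_(i in Nr) \sum_(l in Nc) K l i * M i l = \tr (K *m M).
Proof.
move=> hr hc; rewrite mxtrace_mulC /mxtrace big_supp => [|i iN]; last first.
  by rewrite big1 // => l _; rewrite hr // mulr0.
apply: eq_bigr => i _; rewrite mxE big_supp => [|l lN]; last by rewrite hc // mulr0.
by apply: eq_bigr => l _; rewrite mulrC.
Qed.

(** * Trace identities for the sums of ratios *)

Section TraceIdentities.

Variables (F : realFieldType) (k : nat) (Z W X Y : 'M[F]_k) (Nr Nc : {set 'I_k}).
Hypotheses (uZ : Z \in unitmx) (uW : W \in unitmx).
Hypotheses (XZ : forall i, i \notin Nr -> row i X = row i Z)
           (YW : forall i, i \notin Nr -> row i Y = row i W)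
           (YZ : forall i, i \notin Nc -> col i Y = col i Z)
           (XW : forall i, i \notin Nc -> col i X = col i W).

Let G := invmx Z.
Let G' := invmx W.
Let E := X *m G.
Let E' := Y *m G'.
Let H := G *m Y.
Let H' := G' *m X.
Let D := W - E *m Y.
Let D' := Z - E' *m X.
Let Q := E *m E'.
Let tau := \sum_(j in Nr) \sum_(i in Nr) E j i * E' i j.
Let tauc := \sum_(q in Nc) \sum_(l in Nc) H l q * H' q l.
(** Positions may repeat: if [j = j'] or [i = i'], both minors are zero. *)
Let rho := \sum_(j in Nr) \sum_(j' in Nr) \sum_(i in Nr) \sum_(i' in Nr)
  (E j i * E j' i' - E j i' * E j' i) * (E' i j * E' i' j' - E' i j' * E' i' j).
Let mu := \sum_(j in Nr) \sum_(q in Nc) \sum_(i in Nr) \sum_(l in Nc)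
  (E j i * H l q + G l i * D j q) * (E' i j * H' q l + G' q j * D' i l).

Lemma fixE : fixes_rows Nr E.
Proof. by move=> i iN; rewrite row_mul XZ // -row_mul mulmxV. Qed.

Lemma fixE' : fixes_rows Nr E'.
Proof. by move=> i iN; rewrite row_mul YW // -row_mul mulmxV. Qed.

(** Columns are treated through the transpose, so that the lemmas on fixed rows apply. *)
Lemma fixH : fixes_rows Nc H^T.
Proof.
move=> i iN; rewrite trmx_mul row_mul -tr_col YZ // tr_col -row_mul -trmx_mul mulVmx //.
by rewrite trmx1.
Qed.

Lemma fixH' : fixes_rows Nc H'^T.
Proof.
move=> i iN; rewrite trmx_mul row_mul -tr_col XW // tr_col -row_mul -trmx_mul mulVmx //.
by rewrite trmx1.
Qed.

(** In a common row [E] acts as the identity and [Y] agrees with [W]. The support of [D] and [D'] is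
    what turns sums over non-common positions into traces. *)
Lemma D_row0 i l : i \notin Nr -> D i l = 0.
Proof.
move=> iN; have /rowP/(_ l) : row i D = 0.
  by rewrite /D linearB /= row_mul fixE // -row_mul mul1mx YW // subrr.
by rewrite !mxE.
Qed.

Lemma D'_row0 i l : i \notin Nr -> D' i l = 0.
Proof.
move=> iN; have /rowP/(_ l) : row i D' = 0.
  by rewrite /D' linearB /= row_mul fixE' // -row_mul mul1mx XZ // subrr.
by rewrite !mxE.
Qed.

Lemma D_col0 i l : l \notin Nc -> D i l = 0.
Proof.
move=> lN; have /colP/(_ i) : col l D = 0.
  rewrite /D linearB /= col_mul YZ //.
  by rewrite -col_mul mulmxKV // XW // subrr.
by rewrite !mxE.
Qed.

Lemma D'_col0 i l : l \notin Nc -> D' i l = 0.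
Proof.
move=> lN; have /colP/(_ i) : col l D' = 0.
  rewrite /D' linearB /= col_mul XW //.
  by rewrite -col_mul mulmxKV // YZ // subrr.
by rewrite !mxE.
Qed.

Lemma tauE : tau = \tr Q - (k%:R - #|Nr|%:R).
Proof.
rewrite -(fixes_rows_trace (fixes_rowsM fixE fixE')).
by apply: eq_bigr => j jN; rewrite fixes_rows_sum //; apply: fixE'.
Qed.

(** Both are traces of cyclic rotations of [X Z^-1 Y W^-1]; this links column swaps to row swaps. *)
Lemma tr_HH' : \tr (H' *m H) = \tr Q.
Proof. by rewrite /H' /H /Q /E /E' -!mulmxA mxtrace_mulC -!mulmxA. Qed.

Lemma H'_eq0 l q : l \in Nc -> q \notin Nc -> H' l q = 0.
Proof. by move=> lN qN; rewrite -[H']trmxK mxE (fixes_rows0 fixH'). Qed.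

Lemma HH_sum q : q \in Nc -> \sum_(l in Nc) H l q * H' q l = (H' *m H) q q.
Proof.
move=> qN; rewrite mxE -(big_supp (N := Nc)) => [|l lN].
  by apply: eq_bigr => l _; rewrite mulrC.
by rewrite H'_eq0 // mul0r.
Qed.

Lemma taucE : tauc = \tr Q - (k%:R - #|Nc|%:R).
Proof.
rewrite -tr_HH' -mxtrace_tr trmx_mul.
rewrite -(fixes_rows_trace (fixes_rowsM fixH fixH')).
by apply: eq_bigr => j jN; rewrite HH_sum // -trmx_mul [RHS]mxE.
Qed.

(** As in Cauchy-Binet, summing over [i] and [i'] leaves twice the principal minor
    [Q j j * Q j' j' - Q j j' * Q j' j]. *)
Lemma rhoE : rho = 2 * tau ^+ 2 - 2 * (\tr (Q *m Q) - (k%:R - #|Nr|%:R)).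
Proof.
have fQ : fixes_rows Nr Q by apply: fixes_rowsM fixE fixE'.
rewrite -(fixes_rows_trace (fixes_rowsM fQ fQ)).
have -> : tau = \sum_(j in Nr) Q j j.
  by apply: eq_bigr => j jN; rewrite fixes_rows_sum //; apply: fixE'.
rewrite expr2 mulr_suml -mulrBr -sumrB mulr_sumr; apply: eq_bigr => j jN.
rewrite -(fixes_rows_sum _ _ fQ) // mulr_sumr -sumrB mulr_sumr.
apply: eq_bigr => j' j'N.
rewrite -!(fixes_rows_sum _ _ fixE') // !big_distrlr /= -sumrB.
(* The factor 2 gives two copies of the sum, the second taken with [i] and [i'] exchanged. *)
rewrite [RHS]mulr_natl mulr2n; under [X in _ = X + _]eq_bigr do rewrite -sumrB.
rewrite [X in _ = X + _]exchange_big -big_split.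
apply: eq_bigr => i _; rewrite -sumrB -big_split /=.
by apply: eq_bigr => i' _; ring.
Qed.

(** The numbers [H l q * E j i] form the rank-one matrix [col q H *m row j E]; its trace against
    [D'] is a single entry by cyclicity. *)
Lemma EDH_sum j q :
  \sum_(i in Nr) \sum_(l in Nc) H l q * E j i * D' i l = (E *m D' *m H) j q.
Proof.
have <- : \tr ((col q H *m row j E) *m D') = (E *m D' *m H) j q.
  by rewrite -mulmxA mxtrace_mulC -row_mul -row_mul -col_mul trace_mx11 2!mxE.
rewrite -(sum_supp_trace _ (@D'_row0) (@D'_col0)).
by apply: eq_bigr => i _; apply: eq_bigr => l _; rewrite !mxE big_ord1 !mxE.
Qed.

Lemma HGE_sum j q : j \in Nr -> q \in Nc ->
  \sum_(i in Nr) \sum_(l in Nc) H' q l * G l i * E' i j = (H' *m G *m E') q j.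
Proof.
move=> jN qN; rewrite -(fixes_rows_sum _ _ fixE') //; apply: eq_bigr => i iN.
rewrite [(H' *m G) q i]mxE mulr_suml big_supp // => l lN.
by rewrite H'_eq0 // !mul0r.
Qed.

(** Of the four products in the expansion, one sums to [tau * tauc], one to
    [\tr (G *m D') * \tr (G' *m D)], and the mixed ones to the traces in [T1] and [T2]. *)
Lemma muE : mu = tau * tauc + (k%:R - \tr Q) ^+ 2 + 2 * (\tr Q - \tr (Q *m Q)).
Proof.
have GD' : \tr (G *m D') = k%:R - \tr Q.
  rewrite /D' mulmxBr mulVmx // linearB /= mxtrace1 /Q /E /E' -!mulmxA mxtrace_mulC.
  by rewrite -!mulmxA mxtrace_mulC -!mulmxA mxtrace_mulC -!mulmxA mxtrace_mulC -!mulmxA.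
have G'D : \tr (G' *m D) = k%:R - \tr Q.
  by rewrite /D mulmxBr mulVmx // linearB /= mxtrace1 mxtrace_mulC /Q /E /E' -!mulmxA.
(* [E *m D' *m H] inherits the support of [D'], so its sum against [G'] over [Nr] and [Nc] is a full
   trace. *)
have EDH_row0 i l : i \notin Nr -> (E *m D' *m H) i l = 0.
  move=> iN; rewrite mxE big1 // => p _; rewrite mxE big1 ?mul0r // => o _.
  rewrite (fixes_rowsE _ fixE) //; case: eqVneq => [<-|]; rewrite ?mul0r //.
  by rewrite D'_row0 // mulr0.
have EDH_col0 i l : l \notin Nc -> (E *m D' *m H) i l = 0.
  move=> lN; rewrite -mulmxA mxE big1 // => p _; rewrite [(D' *m H) p l]mxE big1 ?mulr0 // => o _.
  rewrite -[H]trmxK [H^T^T _ _]mxE (fixes_rowsE _ fixH) //.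
  by case: eqVneq => [<-|]; rewrite ?mulr0 // D'_col0 // mul0r.
have T1 : \tr (G' *m (E *m D' *m H)) = \tr Q - \tr (Q *m Q).
  have -> : E *m D' *m H = E *m Y - E *m E' *m X *m H.
    rewrite /D' mulmxBr mulmxBl !mulmxA; congr (_ - _).
    by rewrite mulmxK.
  rewrite mulmxBr linearB /=; congr (_ - _).
    by rewrite mxtrace_mulC /Q /E' !mulmxA.
  by rewrite mxtrace_mulC /Q /E' /E /H -!mulmxA.
have T2 : \tr (H' *m G *m E' *m D) = \tr Q - \tr (Q *m Q).
  have -> : H' *m G *m E' *m D = G' *m (X *m G *m Y) - G' *m (Q *m E *m Y).
    rewrite /D mulmxBr; congr (_ - _).
      by rewrite /H' /E' !mulmxA mulmxKV // !mulmxA.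
    by rewrite /H' /Q /E /E' !mulmxA.
  rewrite linearB /=; congr (_ - _); rewrite mxtrace_mulC.
    by rewrite /Q /E /E' !mulmxA.
  by rewrite /Q /E /E' !mulmxA.
(* For fixed [j] and [q] the sums over [i] and [l] are first collected into matrix entries. *)
rewrite /mu (eq_bigr (fun j => \sum_(q in Nc)
   (Q j j * (H' *m H) q q + G' q j * (E *m D' *m H) j q
    + (H' *m G *m E') q j * D j q + (k%:R - \tr Q) * (G' q j * D j q)))) => [|j jN].
  under eq_bigr do rewrite !big_split /= -!mulr_sumr.
  rewrite !big_split /= -mulr_suml -mulr_sumr.
  rewrite !sum_supp_trace //; try exact: D_row0; try exact: D_col0.
  rewrite T1 T2 G'D.
  have -> : \sum_(j in Nr) Q j j = tau.
    by apply: eq_bigr => j jN; rewrite fixes_rows_sum //; apply: fixE'.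
  have -> : \sum_(q in Nc) (H' *m H) q q = tauc.
    by apply: eq_bigr => j jN; rewrite HH_sum.
  ring.
apply: eq_bigr => q qN.
rewrite -(fixes_rows_sum _ _ fixE') // -HH_sum // -EDH_sum -HGE_sum // -GD'.
rewrite -(sum_supp_trace _ (@D'_row0) (@D'_col0)).
rewrite big_distrlr /= mulr_sumr !mulr_suml -!big_split /=; apply: eq_bigr => i _.
rewrite mulr_sumr !mulr_suml -!big_split /=; apply: eq_bigr => l _.
ring.
Qed.

(** [e] stands for a common bound on all ratios; the four families of bounds control the terms of
    [tau], [tauc], [rho] and [mu]. *)
Lemma exchange_ratio_bound (e : F) :
  0 <= e -> (Nr != set0) || (Nc != set0) ->
  {in Nr &, forall i j, `|E j i * E' i j| <= e} ->
  {in Nc &, forall l q, `|H l q * H' q l| <= e} ->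
  (forall i i' j j', i \in Nr -> i' \in Nr -> j \in Nr -> j' \in Nr ->
    `|(E j i * E j' i' - E j i' * E j' i) * (E' i j * E' i' j' - E' i j' * E' i' j)| <= e) ->
  (forall i j l q, i \in Nr -> j \in Nr -> l \in Nc -> q \in Nc ->
    `|(E j i * H l q + G l i * D j q) * (E' i j * H' q l + G' q j * D' i l)| <= e) ->
  1 <= 4 * k%:R ^+ 2 * e.
Proof.
move=> e0 N0 b1 b2 b3 b4.
pose a : F := #|Nr|%:R; pose b : F := #|Nc|%:R; pose K : F := k%:R.
have aK : a <= K by rewrite ler_nat -[leqRHS]card_ord max_card.
have bK : b <= K by rewrite ler_nat -[leqRHS]card_ord max_card.
have a0 : 0 <= a by apply: ler0n.
have b0 : 0 <= b by apply: ler0n.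
have taub : `|tau| <= a * (a * e).
  by do 2!apply: norm_sum_le => ? ?; apply: b1.
have taucb : `|tauc| <= b * (b * e).
  by do 2!apply: norm_sum_le => ? ?; apply: b2.
have rhob : `|rho| <= a * (a * (a * (a * e))).
  by do 4!apply: norm_sum_le => ? ?; apply: b3.
have mub : `|mu| <= a * (b * (a * (b * e))).
  by do 4!apply: norm_sum_le => ? ?; apply: b4.
have sqK x : 0 <= x -> x <= K -> x * (x * e) <= K ^+ 2 * e.
  by move=> x0 xK; rewrite mulrA -expr2 ler_wpM2r // lerXn2r // nnegrE // (le_trans x0).
have [eN|neN] := eqVneq #|Nr| #|Nc|; last first.
  have dab : 1 <= `|b - a|.
    case: (ltngtP #|Nr| #|Nc|) neN => // lt _; last rewrite distrC;
      by apply: le_trans (ler_norm _); rewrite lerBrDl natr1 ler_nat.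
  (* The traces of [Q] cancel; the left side is a nonzero integer. *)
  have eab : b - a = tauc - tau by rewrite tauE taucE -/a -/b; ring.
  have := le_trans (ler_normB tauc tau) (lerD taucb taub).
  rewrite -eab => h.
  have := sqK _ a0 aK; have := sqK _ b0 bK.
  have K0 : 0 <= K ^+ 2 * e by rewrite mulr_ge0 // exprn_ge0 // ler0n.
  by rewrite -/K -mulrA; lra.
have ab : b = a by rewrite /a /b eN.
have a1 : 1 <= a.
  rewrite ler1n card_gt0; move: N0; rewrite -[Nc != _]card_gt0 -eN card_gt0.
  by rewrite orbb.
(* In [mu - rho] the terms in [tau ^+ 2], [\tr (Q *m Q)] and [k - a] cancel. *)
have key : a ^+ 2 = mu - rho + 2 * (a - 1) * tau.
  have et : tauc = tau by rewrite taucE tauE eN.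
  have eQ : \tr Q = tau + (k%:R - a) by rewrite tauE -/a; ring.
  rewrite muE rhoE et eQ -/a; ring.
rewrite ab in mub; have {}mub := le_trans (ler_norm _) mub.
have {}rhob : - rho <= a * (a * (a * (a * e))).
  by apply: le_trans rhob; rewrite -normrN ler_norm.
have {}taub : 2 * (a - 1) * tau <= 2 * (a - 1) * (a * (a * e)).
  by apply: ler_wpM2l; [lra | apply: le_trans taub; apply: ler_norm].
(* The constant 4 arises here: [mu] and [- rho] give [a ^+ 4 * e] each, and [a - 1 <= a ^+ 2] bounds
   the last term by twice that. *)
have h : a ^+ 2 <= a ^+ 2 * (4 * a ^+ 2 * e).
  have : (a - 1) * (a * (a * e)) <= a * a * (a * (a * e)).
    by apply: ler_wpM2r; [rewrite !mulr_ge0 | nra].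
  by rewrite {1}key; lra.
have a2 : 0 < a ^+ 2 by rewrite exprn_gt0 // (lt_le_trans ltr01).
rewrite -[leLHS]mulr1 ler_pM2l // in h; apply: le_trans h _.
by rewrite -![4 * _ * _]mulrA ler_wpM2l // [a ^+ 2]expr2 -mulrA sqK.
Qed.

End TraceIdentities.

(** * Enumerations of index sets *)

(** The order is left free, so that common indices can be given common positions. *)
Definition enumerates (I : finType) (k : nat) (r : 'I_k -> I) (X : {set I}) :=
  injective r /\ r @: setT = X.

Lemma enumerates_card (I : finType) (k : nat) (r : 'I_k -> I) X :
  enumerates r X -> #|X| = k.
Proof. by case=> ri <-; rewrite card_imset // cardsT card_ord. Qed.

Lemma enumerates_mem (I : finType) (k : nat) (r : 'I_k -> I) X i :
  enumerates r X -> r i \in X.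
Proof. by case=> ri <-; rewrite imset_f. Qed.

Lemma enumerates_perm (I : finType) (k : nat) (f g : 'I_k -> I) X :
  enumerates f X -> enumerates g X -> exists s : 'S_k, f =1 g \o s.
Proof.
move=> [fi fX] [gi gX].
have /fin_all_exists[h hE] (i : 'I_k) : exists j, f i = g j.
  have : f i \in g @: setT by rewrite gX -fX imset_f.
  by case/imsetP => j _ ->; exists j.
have hi : injective h by move=> x y e; apply: fi; rewrite !hE e.
by exists (perm hi) => i; rewrite /= permE.
Qed.

(** Enumerations of one set differ by a permutation, which affects only the sign of the
    determinant. *)
Lemma abs_det_mxsub (R : realDomainType) (m n k : nat) (A : 'M[R]_(m, n))
    (r f : 'I_k -> 'I_m) (c g : 'I_k -> 'I_n) X Y :
  enumerates r X -> enumerates f X -> enumerates c Y -> enumerates g Y ->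
  `|\det (mxsub r c A)| = `|\det (mxsub f g A)|.
Proof.
move=> rX fX cY gY.
have [s rs] := enumerates_perm rX fX; have [t ct] := enumerates_perm cY gY.
have -> : mxsub r c A = row_perm s (col_perm t (mxsub f g A)).
  by apply/matrixP => i j; rewrite !mxE rs ct.
by rewrite row_permE col_permE !det_mulmx !det_perm !normrM !normr_sign mul1r mulr1.
Qed.

Lemma abs_det_submatrix (R : realDomainType) (m n k : nat) (A : 'M[R]_(m, n))
    (r : 'I_k -> 'I_m) (c : 'I_k -> 'I_n) (S : idxpair m n) :
  enumerates r S.1 -> enumerates c S.2 ->
  `|\det (submatrix k A S)| = `|\det (mxsub r c A)|.
Proof.
move=> rS cS.
have hR := esym (enumerates_card rS); have hC := esym (enumerates_card cS).
have enumP (I : finType) (X : {set I}) (h : k = #|X|) :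
    enumerates (fun i => enum_val (cast_ord h i)) X.
  have inj : injective (fun i => enum_val (cast_ord h i)).
    by move=> x y /enum_val_inj/cast_ord_inj.
  split=> //; apply/eqP.
  rewrite eqEcard card_imset // cardsT card_ord (eq_leq (esym h)) andbT.
  by apply/subsetP => _ /imsetP[i _ ->]; apply: enum_valP.
rewrite (abs_det_mxsub A rS (enumP _ _ hR) cS (enumP _ _ hC)).
congr (`|\det _|); apply/matrixP => i j.
by rewrite submatrixE [RHS]mxE.
Qed.

Lemma enumerates_tnth (I : finType) (k : nat) (t : k.-tuple I) :
  uniq t -> enumerates (tnth t) [set x in t].
Proof.
move=> ut; split; first exact/tuple_uniqP.
by apply/setP => x; rewrite inE; apply/imsetP/tnthP => [[i _ ->]|[i ->]]; exists i.
Qed.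

(** Both lists start with the same enumeration of [X :&: Y]; the tails enumerate the two
    differences. *)
Lemma aligned_enumerations (I : finType) (k : nat) (X Y : {set I}) :
  #|X| = k -> #|Y| = k ->
  exists r r' : 'I_k -> I, [/\ enumerates r X, enumerates r' Y &
    forall i, r i != r' i -> (r i \notin Y) && (r' i \notin X)].
Proof.
move=> cX cY; pose com := enum (X :&: Y).
have mk (P Q : {set I}) : #|P| = k -> P :&: Q = X :&: Y ->
  exists t : k.-tuple I,
    [/\ uniq t, [set x in t] = P & tval t = com ++ enum (P :\: Q)].
  move=> cP e; have sz : size (com ++ enum (P :\: Q)) == k.
    by rewrite size_cat -!cardE -e cardsID cP.
  exists (Tuple sz); split=> //=.
    rewrite cat_uniq !enum_uniq andbT /=; apply/hasPn => x.
    by rewrite !mem_enum -e !inE => /andP[/negPf-> _]; rewrite andbF.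
  apply/setP => x; rewrite !inE mem_cat !mem_enum -e !inE.
  by case: (x \in Q); rewrite ?andbT ?andbF ?orbF.
have [t [ut tX te]] := mk X Y cX erefl.
have [t' [ut' tY te']] := mk Y X cY (setIC _ _).
exists (tnth t), (tnth t'); split.
- by rewrite -tX; apply: enumerates_tnth.
- by rewrite -tY; apply: enumerates_tnth.
move=> i; have x0 := tnth t i.
rewrite !(tnth_nth x0) te te' !nth_cat; case: ltnP => [_|ge]; first by rewrite eqxx.
move=> _.
have lt (u : k.-tuple I) s : tval u = com ++ s -> (i - size com < size s)%N.
  by move=> e; rewrite ltn_subLR // -size_cat -e size_tuple.
have := mem_nth x0 (lt _ _ te); have := mem_nth x0 (lt _ _ te').
by rewrite !mem_enum !inE => /andP[-> _] /andP[-> _].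
Qed.

(** * Exchanges as updates of enumerations *)

Lemma symdiffA (I : finType) (X Y Z : {set I}) :
  symdiff (symdiff X Y) Z = symdiff X (symdiff Y Z).
Proof.
by apply/setP => x; rewrite !inE; case: (x \in X); case: (x \in Y); case: (x \in Z).
Qed.

Lemma symdiffX0 (I : finType) (X : {set I}) : symdiff X set0 = X.
Proof. by rewrite /symdiff setD0 set0D setU0. Qed.

Lemma enumerates_upd (I : finType) (k : nat) (r : 'I_k -> I) X i y :
  enumerates r X -> y \notin X -> enumerates (upd r i y) (symdiff X [set r i; y]).
Proof.
move=> rX yX; have rm j := enumerates_mem j rX.
case: (rX) => ri rE; split.
  move=> p q; rewrite /upd; case: eqVneq => [->|_]; case: eqVneq => [->|_] // e.
  - by move: yX; rewrite e rm.
  - by move: yX; rewrite -e rm.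
  - exact: ri.
apply/setP => x; rewrite !inE; apply/imsetP/idP => [[p _ ->]|].
  rewrite /upd; case: (eqVneq p i) => [_|pi]; first by rewrite eqxx yX !orbT.
  rewrite rm (inj_eq ri) (negPf pi) /= ?andbT ?orbF.
  by apply: contraNneq yX => <-.
case/orP => [/andP[]|/andP[xX /orP[/eqP xr|/eqP->]]].
- rewrite negb_or -rE => /andP[xi xy] /imsetP[p _ xp]; exists p => //.
  by rewrite /upd; case: (eqVneq p i) => // pi; rewrite xp pi eqxx in xi.
- by rewrite xr rm in xX.
- by exists i => //; rewrite /upd eqxx.
Qed.

Section Swaps.

Variables (I : finType) (k : nat) (r r' : 'I_k -> I) (X Y : {set I}).
Hypotheses (rX : enumerates r X) (rY : enumerates r' Y).
Hypothesis (rr' : forall i, r i != r' i -> (r i \notin Y) && (r' i \notin X)).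

Let N := [set i | r i != r' i].

(** The positions are independent: [r' j] enters [X] at position [i], and [r i] enters [Y] at
    position [j]. Hence the transposed indices in the two factors of a ratio. *)
Lemma swap1P i j : i \in N -> j \in N ->
  let U := [set r i; r' j] in
  [/\ U \subset symdiff X Y, #|U| = 2,
      enumerates (upd r i (r' j)) (symdiff X U) &
      enumerates (upd r' j (r i)) (symdiff Y U)].
Proof.
rewrite !inE => /rr'/andP[iY _] /rr'/andP[_ jX] U.
have iX := enumerates_mem i rX; have jY := enumerates_mem j rY.
split.
- apply/subsetP => z; rewrite !inE => /orP[/eqP->|/eqP->].
    by rewrite iX iY.
  by rewrite jX jY orbT.
- by rewrite cards2; case: eqVneq jX => // <-; rewrite iX.
- exact: enumerates_upd.
- by rewrite /U setUC; apply: enumerates_upd.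
Qed.

(** Distinct positions make the two pairs disjoint. Writing [U] as a symmetric difference lets the
    second update be applied after the first. *)
Lemma swap2P i j i' j' : i \in N -> j \in N -> i' \in N -> j' \in N -> i != i' -> j != j' ->
  let U := symdiff [set r i; r' j] [set r i'; r' j'] in
  [/\ U \subset symdiff X Y, #|U| = 4,
      enumerates (upd (upd r i (r' j)) i' (r' j')) (symdiff X U) &
      enumerates (upd (upd r' j (r i)) j' (r i')) (symdiff Y U)].
Proof.
move=> iN jN iN' jN' ii' jj' U.
have [s1 c1 e1 f1] := swap1P iN jN; have [s2 c2 e2 f2] := swap1P iN' jN'.
move: iN jN iN' jN'; rewrite !inE.
move=> /rr'/andP[iY _] /rr'/andP[_ jX] /rr'/andP[iY' _] /rr'/andP[_ jX'].
have iX := enumerates_mem i rX; have jY := enumerates_mem j rY.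
have iX' := enumerates_mem i' rX; have jY' := enumerates_mem j' rY.
have [ri _] := rX; have [ri' _] := rY.
have nrr a b : r a \in X -> r' b \notin X -> (r a == r' b) = false.
  by move=> h h'; case: eqVneq h' => // <-; rewrite h.
have d : [disjoint [set r i; r' j] & [set r i'; r' j']].
  rewrite -setI_eq0; apply/eqP/setP => x; rewrite !inE; apply/negP.
  case/andP => /orP[/eqP->|/eqP->].
  - by rewrite (inj_eq ri) (negPf ii') nrr.
  - by rewrite (inj_eq ri') (negPf jj') eq_sym nrr.
have UE : U = [set r i; r' j] :|: [set r i'; r' j'].
  rewrite /U; move: [set r i; r' j] [set r i'; r' j'] d => A B.
  rewrite -setI_eq0 => /eqP/setP d; apply/setP => x; have := d x.
  by rewrite !inE; case: (x \in A); case: (x \in B).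
split.
- by rewrite UE subUset s1 s2.
- by rewrite UE cardsU disjoint_setI0 // cards0 subn0 c1 c2.
- rewrite -symdiffA.
  (* The first update leaves position [i'] unchanged. *)
  have -> : r i' = upd r i (r' j) i' by rewrite /upd eq_sym (negPf ii').
  apply: enumerates_upd => //; rewrite !inE (negPf jX') andbF /=.
  by rewrite [r' j' == r i]eq_sym nrr // (inj_eq ri') [j' == j]eq_sym (negPf jj').
- rewrite -symdiffA [[set r i'; _]]setUC.
  have -> : r' j' = upd r' j (r i) j' by rewrite /upd eq_sym (negPf jj').
  apply: enumerates_upd => //; rewrite !inE (negPf iY') andbF /=.
  by rewrite nrr // (inj_eq ri) [i' == i]eq_sym (negPf ii').
Qed.

Lemma swap_neq0 : X != Y -> N != set0.
Proof.
apply: contraNneq => N0; apply/eqP.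
case: rX rY => _ <- [_ <-]; apply: eq_imset => i; apply/eqP.
by apply: contraTT isT => ne; have := in_set0 i; rewrite -N0 inE ne.
Qed.

End Swaps.

(** * From ratios of determinants to the maximum over exchanges *)

(** Being enumerated by ['I_k] gives all four sets size [k]; cardinalities 2 and 4 are the 1- and
    2-exchanges. *)
Lemma exchange_le (R : realType) (m n k : nat) (A : 'M[R]_(m, n)) (S T U : idxpair m n)
    (r r' : 'I_k -> 'I_m) (c c' : 'I_k -> 'I_n) :
  pair_subset U (pair_symdiff S T) -> pair_card U \in [:: 2; 4]%N ->
  enumerates r (symdiff S.1 U.1) -> enumerates c (symdiff S.2 U.2) ->
  enumerates r' (symdiff T.1 U.1) -> enumerates c' (symdiff T.2 U.2) ->
  `|\det (mxsub r c A)| * `|\det (mxsub r' c' A)| <= max_exchange k A S T.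
Proof.
move=> sU cU er ec er' ec'.
rewrite -(abs_det_submatrix A (S := pair_symdiff S U) er ec).
rewrite -(abs_det_submatrix A (S := pair_symdiff T U) er' ec').
apply: (le_bigmax_cond _ (fun U => `|\det (submatrix k A (pair_symdiff S U))| *
     `|\det (submatrix k A (pair_symdiff T U))|)).
rewrite inE /is_exchange sU !inE /= (enumerates_card er) (enumerates_card ec).
rewrite (enumerates_card er') (enumerates_card ec') eqxx !andbT.
by move: cU; rewrite !inE.
Qed.

Lemma max_exchange_ge0 (R : realType) (m n k : nat) (A : 'M[R]_(m, n)) (S T : idxpair m n) :
  0 <= max_exchange k A S T.
Proof. exact: bigmax_ge_id. Qed.

Theorem theorem4p2 (R : realType) :
  exists C : R, 0 < C /\
    forall (m n k : nat) (A : 'M[R]_(m, n)) (S T : idxpair m n),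
      (1 <= k)%N -> (k <= minn m n)%N ->
      S \in index_set m n k -> T \in index_set m n k -> S <> T ->
      `|\det (submatrix k A S)| * `|\det (submatrix k A T)|
        <= C * k%:R ^+ 2 * max_exchange k A S T.
Proof.
exists 4; split=> // m n k A S T _ _.
rewrite !inE => /andP[/eqP RS /eqP CS] /andP[/eqP RT /eqP CT] /eqP neST.
have [r [r' [rS rT rr']]] := aligned_enumerations RS RT.
have [c [c' [cS cT cc']]] := aligned_enumerations CS CT.
rewrite (abs_det_submatrix A rS cS) (abs_det_submatrix A rT cT).
set Z := mxsub r c A; set W := mxsub r' c' A.
have M0 := max_exchange_ge0 k A S T; set M := max_exchange k A S T in M0 *.
have K0 : 0 <= 4 * k%:R ^+ 2 * M by rewrite !mulr_ge0 // exprn_ge0 // ler0n.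
have [dZ|dZ] := eqVneq (\det Z) 0; first by rewrite dZ normr0 mul0r.
have [dW|dW] := eqVneq (\det W) 0; first by rewrite dW normr0 mulr0.
have uZ : Z \in unitmx by rewrite unitmxE unitfE.
have uW : W \in unitmx by rewrite unitmxE unitfE.
have d0 : 0 < `|\det Z| * `|\det W| by rewrite mulr_gt0 // normr_gt0.
have ratio (x y : R) : `|\det Z * x| * `|\det W * y| <= M ->
    `|x * y| <= M / (`|\det Z| * `|\det W|).
  by rewrite ler_pdivlMr // !normrM; congr (_ <= _); ring.
(* After division by the positive product of determinants, the ratio bound is applied with [e] equal
   to [M] over that product. *)
rewrite -[leLHS]mul1r -ler_pdivlMr // -[leRHS]mulrA.
pose Nr := [set i | r i != r' i]; pose Nc := [set i | c i != c' i].
apply: (@exchange_ratio_bound _ k Z W (mxsub r' c A) (mxsub r c' A) Nr Nc) => //.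
- by move=> i; rewrite inE negbK => /eqP e; apply/rowP => j; rewrite !mxE e.
- by move=> i; rewrite inE negbK => /eqP e; apply/rowP => j; rewrite !mxE e.
- by move=> i; rewrite inE negbK => /eqP e; apply/colP => j; rewrite !mxE e.
- by move=> i; rewrite inE negbK => /eqP e; apply/colP => j; rewrite !mxE e.
- by rewrite divr_ge0 // ltW.
- have : (S.1 != T.1) || (S.2 != T.2) by rewrite -negb_and -[_ && _]/(S == T).
  case/orP => ne; apply/orP; [left|right].
    exact: swap_neq0 rS rT ne.
  exact: swap_neq0 cS cT ne.
- move=> i j iN jN; apply: ratio.
  rewrite -det_replace_row // -det_replace_row //.
  have [s cU e1 e2] := swap1P rS rT rr' iN jN.
  apply: (@exchange_le _ _ _ _ _ _ _ ([set r i; r' j], set0)) => //=.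
  + by rewrite /pair_subset /= s sub0set.
  + by rewrite /pair_card /= cU cards0.
  + by rewrite symdiffX0.
  + by rewrite symdiffX0.
- move=> l q lN qN; apply: ratio.
  rewrite -det_replace_col // -det_replace_col //.
  have [s cU e1 e2] := swap1P cS cT cc' lN qN.
  apply: (@exchange_le _ _ _ _ _ _ _ (set0, [set c l; c' q])) => //=.
  + by rewrite /pair_subset /= s sub0set.
  + by rewrite /pair_card /= cU cards0.
  + by rewrite symdiffX0.
  + by rewrite symdiffX0.
- move=> i i' j j' iN iN' jN jN'.
  have e0 : 0 <= M / (`|\det Z| * `|\det W|) by rewrite divr_ge0 // ltW.
  (* Repeated positions give no exchange, but then the minors vanish. *)
  have [<-|ii'] := eqVneq i i'; first by rewrite subrr mul0r normr0.
  have [<-|jj'] := eqVneq j j'.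
    by rewrite subrr mulr0 normr0.
  apply: ratio; rewrite -det_replace_2rows // -det_replace_2rows //.
  have [s cU e1 e2] := swap2P rS rT rr' iN jN iN' jN' ii' jj'.
  apply: (@exchange_le _ _ _ _ _ _ _
    (symdiff [set r i; r' j] [set r i'; r' j'], set0)) => //=.
  + by rewrite /pair_subset /= s sub0set.
  + by rewrite /pair_card /= cU cards0.
  + by rewrite symdiffX0.
  + by rewrite symdiffX0.
- move=> i j l q iN jN lN qN; apply: ratio.
  rewrite -det_replace_row_col // -det_replace_row_col //.
  have [sr cr e1 e2] := swap1P rS rT rr' iN jN.
  have [sc cc e3 e4] := swap1P cS cT cc' lN qN.
  apply: (@exchange_le _ _ _ _ _ _ _ ([set r i; r' j], [set c l; c' q])) => //=.
  + by rewrite /pair_subset /= sr sc.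
  + by rewrite /pair_card /= cr cc.
Qed.
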